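(* Let $L>0$, let $(\widetilde A,\widetilde V)$ with $\widetilde A>0$ be a constant subcritical equilibrium, i.e. $\widetilde V^2<g\widetilde AH'(\widetilde A)$, and put $\lambda_1=\widetilde V-\sqrt{g\widetilde AH'(\widetilde A)}<0<\lambda_2=\widetilde V+\sqrt{g\widetilde AH'(\widetilde A)}$. Consider the control system $$r_t+\lambda_1r_x=0,\qquad s_t+\lambda_2s_x=0,$$ $$r(t,L)-r(t,0)=-\widetilde A\,h(t),\qquad s(t,L)-s(t,0)=\widetilde A\,h(t),$$ with the single scalar control $h$. This system is not exactly controllable by means of $h$: for every $T>0$ and every constant $\alpha>0$ with $\alpha\lambda_2+\lambda_1>0$, for the constant initial data $(r_0,s_0)=(\alpha\lambda_2,\lambda_1)$ (which satisfy $r_0+s_0>0$) there is no control $h\in C^1[0,T]$ for which the system with $r(0,x)=r_0$, $s(0,x)=s_0$ ($0\le x\le L$) admits a $C^1$ solution $(r,s)$ on $\{(t,x)\mid 0\le t\le T,\ 0\le x\le L\}$ satisfying $r(T,x)=s(T,x)=0$ for $0\le x\le L$.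
   Context: $g>0$ is the gravity constant and $H$ is a $C^1$ function of $A$ with $H'(A)>0$ for all $A>0$. The system in $(r,s)$ is the diagonal form of the linearized Saint-Venant system $A_t+\widetilde VA_x+\widetilde AV_x=0$, $V_t+gH'(\widetilde A)A_x+\widetilde VV_x=0$ with boundary conditions $A(t,L)-A(t,0)=0$, $V(t,L)-V(t,0)=h(t)$ (corresponding to a loop), through $r=\sqrt{g\widetilde AH'(\widetilde A)}\,A-\widetilde A\,V$ and $s=\sqrt{g\widetilde AH'(\widetilde A)}\,A+\widetilde A\,V$. *)

(* Defs.v *)
From Stdlib Require Import Reals.
From Coquelicot Require Import Coquelicot.

Open Scope R_scope.

Definition Icc (a b : R) : R -> Prop := fun y => a <= y <= b.

Definition rectangle (T L : R) : R * R -> Prop :=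
  fun p => Icc 0 T (fst p) /\ Icc 0 L (snd p).

(* [D_in f d D y] takes the limit of the difference quotient inside [D] only,
   so derivatives at the endpoints of a closed interval are one-sided and the
   values of functions outside the interval are irrelevant. *)
Definition C1_on_Icc (a b : R) (f df : R -> R) : Prop :=
  (forall y, Icc a b y -> D_in f df (Icc a b) y) /\
  continuous_on (Icc a b) df.

(* [f] is C^1 on the closed rectangle, with first partial derivatives [ft] and
   [fx] there (one-sided on the sides of the rectangle); [ft] and [fx] are
   jointly continuous up to the boundary. *)
Definition C1_on_rectangle (T L : R) (f ft fx : R -> R -> R) : Prop :=
  (forall t x, Icc 0 T t -> Icc 0 L x ->
     D_in (fun t' => f t' x) (fun t' => ft t' x) (Icc 0 T) t /\
     D_in (fun x' => f t x') (fun x' => fx t x') (Icc 0 L) x) /\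
  continuous_on (rectangle T L) (fun p => f (fst p) (snd p)) /\
  continuous_on (rectangle T L) (fun p => ft (fst p) (snd p)) /\
  continuous_on (rectangle T L) (fun p => fx (fst p) (snd p)).

Definition loop_solution (T L lam1 lam2 Abar : R) (h : R -> R)
    (r s : R -> R -> R) : Prop :=
  exists rt rx st sx : R -> R -> R,
    C1_on_rectangle T L r rt rx /\
    C1_on_rectangle T L s st sx /\
    (forall t x, Icc 0 T t -> Icc 0 L x ->
       rt t x + lam1 * rx t x = 0 /\ st t x + lam2 * sx t x = 0) /\
    (forall t, Icc 0 T t ->
       r t L - r t 0 = - Abar * h t /\ s t L - s t 0 = Abar * h t).

Definition steerable (T L lam1 lam2 Abar : R)
    (r0 s0 rT sT : R -> R) : Prop :=
  exists h dh : R -> R, C1_on_Icc 0 T h dh /\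
  exists r s : R -> R -> R,
    loop_solution T L lam1 lam2 Abar h r s /\
    (forall x, Icc 0 L x -> r 0 x = r0 x /\ s 0 x = s0 x) /\
    (forall x, Icc 0 L x -> r T x = rT x /\ s T x = sT x).

(* C^1 states that can occur as a time slice of a C^1 solution for some control.
   The two equations eliminate h(t) and h'(t): adding the boundary conditions
   gives the first one; adding their time derivatives and replacing r_t, s_t by
   - lam1 r_x, - lam2 s_x gives the second one. *)
Definition C1_compatible (L lam1 lam2 : R) (r0 s0 : R -> R) : Prop :=
  exists dr0 ds0 : R -> R,
    C1_on_Icc 0 L r0 dr0 /\ C1_on_Icc 0 L s0 ds0 /\
    (r0 L - r0 0) + (s0 L - s0 0) = 0 /\
    lam1 * (dr0 L - dr0 0) + lam2 * (ds0 L - ds0 0) = 0.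

(* Only compatible data are quantified over: incompatible data could never be
   joined, which would make the failure of controllability trivial. *)
Definition exactly_controllable (T L lam1 lam2 Abar : R) : Prop :=
  forall r0 s0 rT sT : R -> R,
    C1_compatible L lam1 lam2 r0 s0 ->
    C1_compatible L lam1 lam2 rT sT ->
    steerable T L lam1 lam2 Abar r0 s0 rT sT.

(* Main.v *)
Require Import Defs.
From Stdlib Require Import Reals Lra.
From Coquelicot Require Import Coquelicot.

Open Scope R_scope.

(** The difference of the boundary data is carried entirely by the scalar [h],
    so one combination of the two masses escapes the control.  Integrating the
    transport equation [u_t + lam * u_x = 0] over the loop gives
    [d/dt \int u = - lam * (u(t,L) - u(t,0))]; hence the mass of [r] changes at
    the rate [lam1 * Abar * h] and the mass of [s] at the rate
    [- lam2 * Abar * h], and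
    [lam2 * \int r + lam1 * \int s]
    is conserved whatever [h] is ([loop_invariant]).  At the state
    [(alpha * lam2, lam1)] it equals [L * (alpha * lam2 ^ 2 + lam1 ^ 2) > 0],
    and at the null state it vanishes, so the latter cannot be reached from the
    former ([constant_data_not_steerable_to_zero]); constant states are
    compatible, so exact controllability fails as well.

    Solutions and their derivatives are only meaningful on the closed
    rectangle.  They are extended to the plane by freezing each variable at the
    nearest point of its interval ([clamp]): the extension of a function that is
    continuous on the rectangle is continuous everywhere, and in the interior
    the time derivative is the given one.  The mass is then differentiated
    under the integral sign for [0 < t < T], its continuity up to [t = 0] and
    [t = T] is proved separately, and the mean value theorem joins the two. *)

(** * Extension from a closed interval and from a rectangle *)

Definition clamp (a b y : R) : R := Rmax a (Rmin b y).

Lemma clamp_Icc (a b y : R) : a <= b -> Icc a b (clamp a b y).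
Proof.
  intros Hab; unfold Icc, clamp, Rmax, Rmin.
  repeat destruct Rle_dec; lra.
Qed.

Lemma clamp_id (a b y : R) : Icc a b y -> clamp a b y = y.
Proof.
  unfold Icc, clamp, Rmax, Rmin; intros Hy.
  repeat destruct Rle_dec; lra.
Qed.

Lemma clamp_lipschitz (a b y z : R) :
  Rabs (clamp a b y - clamp a b z) <= Rabs (y - z).
Proof.
  unfold clamp, Rmax, Rmin, Rabs.
  repeat destruct Rle_dec; repeat destruct Rcase_abs; lra.
Qed.

Lemma continuous_clamp (a b y : R) (f : R -> R) :
  a <= b -> continuous_on (Icc a b) f ->
  continuous (fun z => f (clamp a b z)) y.
Proof.
  intros Hab Hf.
  apply filterlim_comp with (within (Icc a b) (locally (clamp a b y))).
  - intros P [d Hd]; exists d; intros z Hz.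
    apply Hd; [ | now apply clamp_Icc ].
    apply Rle_lt_trans with (2 := Hz), clamp_lipschitz.
  - apply Hf, clamp_Icc, Hab.
Qed.

Lemma continuity_2d_pt_clamp (T L : R) (f : R -> R -> R) (t x : R) :
  0 <= T -> 0 <= L ->
  continuous_on (rectangle T L) (fun p => f (fst p) (snd p)) ->
  continuity_2d_pt (fun t x => f (clamp 0 T t) (clamp 0 L x)) t x.
Proof.
  intros HT HL Hf.
  apply continuity_2d_pt_filterlim.
  apply (filterlim_comp _ _ _ (fun p => (clamp 0 T (fst p), clamp 0 L (snd p)))
    (fun p => f (fst p) (snd p)) _
    (within (rectangle T L) (locally (clamp 0 T t, clamp 0 L x)))).
  - intros P [d Hd]; exists d; intros [t' x'] [Ht Hx].
    apply Hd; [ split | split; now apply clamp_Icc ].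
    + apply Rle_lt_trans with (2 := Ht), clamp_lipschitz.
    + apply Rle_lt_trans with (2 := Hx), clamp_lipschitz.
  - apply (Hf (clamp 0 T t, clamp 0 L x)).
    split; now apply clamp_Icc.
Qed.

Lemma continuity_2d_pt_snd (f : R -> R -> R) (t x : R) :
  continuity_2d_pt f t x -> continuous (f t) x.
Proof.
  intros Hf; apply continuity_pt_filterlim.
  intros eps Heps; destruct (Hf (mkposreal eps Heps)) as [d Hd].
  exists d; split; [ apply cond_pos | ].
  intros y [_ Hy]; apply Hd; [ | exact Hy ].
  rewrite Rminus_diag, Rabs_R0; apply cond_pos.
Qed.

Lemma D_in_continuous_on (a b : R) (f df : R -> R) :
  (forall y, Icc a b y -> D_in f df (Icc a b) y) -> continuous_on (Icc a b) f.
Proof.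
  intros Hf y Hy P [eps HP].
  destruct (cont_deriv _ _ _ _ (Hf y Hy) eps (cond_pos eps)) as [d [Hd HH]].
  exists (mkposreal d Hd); intros z Hz Dz; apply HP.
  (* limits in [D_in] ignore the point itself *)
  destruct (Req_dec z y) as [-> | Hne]; [ apply ball_center | ].
  apply HH; split; [ split | ]; auto.
Qed.

Lemma is_derive_clamp (a b y : R) (f df : R -> R) :
  D_in f df (Icc a b) y -> a < y < b ->
  is_derive (fun z => f (clamp a b z)) y (df y).
Proof.
  intros Hf Hy; apply is_derive_Reals; intros eps Heps.
  destruct (Hf eps Heps) as [d [Hd HH]].
  assert (Hm : 0 < Rmin d (Rmin (y - a) (b - y))) by (repeat apply Rmin_pos; lra).
  exists (mkposreal _ Hm); simpl; intros k Hk0 Hk.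
  pose proof (Rlt_le_trans _ _ _ Hk (Rmin_l _ _)) as Hkd.
  pose proof (Rlt_le_trans _ _ _ Hk (Rmin_r _ _)) as Hk'.
  pose proof (Rlt_le_trans _ _ _ Hk' (Rmin_l _ _)) as Hka.
  pose proof (Rlt_le_trans _ _ _ Hk' (Rmin_r _ _)) as Hkb.
  apply Rabs_def2 in Hka; apply Rabs_def2 in Hkb.
  assert (Hyk : Icc a b (y + k)) by (unfold Icc; lra).
  rewrite (clamp_id a b (y + k) Hyk), (clamp_id a b y) by (unfold Icc; lra).
  specialize (HH (y + k)); simpl in HH; unfold Rdist in HH.
  replace (y + k - y) with k in HH by ring.
  apply HH; repeat split; [ apply Hyk | apply Hyk | lra | exact Hkd ].
Qed.

(** The interior derivative determines the function up to a constant on the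
    open interval only; continuity of [f] at the endpoints, which the one-sided
    derivatives there provide, extends this to the closed interval. *)
Lemma RInt_one_sided_derivative (a b : R) (f df : R -> R) :
  a < b -> C1_on_Icc a b f df -> RInt df a b = f b - f a.
Proof.
  intros Hab [Hf Hdf].
  assert (Hle : a <= b) by lra.
  pose (k := fun z => df (clamp a b z)).
  assert (Hk : forall z, continuous k z)
    by (intros z; now apply continuous_clamp).
  assert (HK : forall z, is_derive (RInt k a) z (k z)).
  { intros z; apply is_derive_RInt with a; [ | apply Hk ].
    apply filter_forall; intros w; apply (RInt_correct (V := R_CompleteNormedModule)).
    apply ex_RInt_continuous; intros; apply Hk. }
  destruct (MVT_gen (fun z => f (clamp a b z) - RInt k a z) a b (fun _ => 0))
    as [c [_ Hc]].
  - rewrite Rmin_left, Rmax_right by lra; intros z Hz.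
    assert (Iz : Icc a b z) by (unfold Icc; lra).
    replace 0 with (minus (df z) (k z))
      by (unfold k; rewrite clamp_id by exact Iz; apply (minus_eq_zero (df z))).
    apply (is_derive_minus (V := R_NormedModule)); [ | apply HK ].
    apply is_derive_clamp; auto.
  - intros z _; apply continuity_pt_filterlim.
    apply (continuous_minus (V := R_NormedModule)
      (fun z => f (clamp a b z)) (RInt k a)).
    + apply continuous_clamp; [ lra | ]; apply D_in_continuous_on with df, Hf.
    + apply (ex_derive_continuous (V := R_NormedModule)).
      exists (k z); apply HK.
  - rewrite !clamp_id, RInt_point in Hc by (unfold Icc; lra).
    change (@zero R_CompleteNormedModule) with 0 in Hc.
    rewrite (RInt_ext df k).
    + unfold minus, plus, opp in Hc; simpl in Hc; lra.
    + rewrite Rmin_left, Rmax_right by lra; intros z Hz; unfold k.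
      now rewrite clamp_id by (unfold Icc; lra).
Qed.

(** By compactness of [Icc a b], a jointly continuous [F] is continuous in [t]
    uniformly in the integration variable. *)
Lemma continuous_RInt_param (F : R -> R -> R) (a b t : R) :
  a < b -> (forall t x, continuity_2d_pt F t x) ->
  continuous (fun t => RInt (F t) a b) t.
Proof.
  intros Hab HF.
  assert (Hex : forall t, ex_RInt (F t) a b).
  { intros t'; apply (ex_RInt_continuous (V := R_CompleteNormedModule)).
    intros x _; apply continuity_2d_pt_snd, HF. }
  apply continuity_pt_filterlim; intros eps Heps.
  assert (He : 0 < eps / (2 * (b - a)))
    by (apply Rdiv_lt_0_compat; lra).
  destruct (uniform_continuity_2d_1d' F a b t (fun x _ => HF t x)
    (mkposreal _ He)) as [d Hd].
  exists d; split; [ apply cond_pos | ].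
  intros t' [_ Ht']; simpl in Ht' |- *; unfold Rdist in *.
  apply Rabs_def2 in Ht'.
  rewrite <- (RInt_minus (V := R_CompleteNormedModule) (F t') (F t)) by apply Hex.
  apply Rle_lt_trans with ((b - a) * (eps / (2 * (b - a)))).
  - apply abs_RInt_le_const; [ lra | | ].
    + apply (ex_RInt_minus (V := R_NormedModule)); apply Hex.
    + intros x Hx; apply Rlt_le, Hd; try lra.
      rewrite Rminus_diag, Rabs_R0; apply cond_pos.
  - replace ((b - a) * (eps / (2 * (b - a)))) with (eps / 2) by (field; lra).
    lra.
Qed.

(** * Mass balance on the loop *)

(** The clamped variables make the mass meaningful, with a continuous
    integrand, at every time. *)
Definition mass (T L : R) (u : R -> R -> R) (t : R) : R :=
  RInt (fun x => u (clamp 0 T t) (clamp 0 L x)) 0 L.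

Lemma mass_const (T L : R) (u : R -> R -> R) (t c : R) :
  0 < L -> Icc 0 T t -> (forall x, Icc 0 L x -> u t x = c) ->
  mass T L u t = L * c.
Proof.
  intros HL Ht Hu; unfold mass.
  rewrite (RInt_ext _ (fun _ => c)).
  - rewrite (RInt_const (V := R_CompleteNormedModule)).
    unfold scal; simpl; unfold mult; simpl; ring.
  - intros x _; rewrite (clamp_id 0 T t Ht).
    apply Hu, clamp_Icc; lra.
Qed.

Lemma continuous_mass (T L : R) (u ut ux : R -> R -> R) (t : R) :
  0 < T -> 0 < L -> C1_on_rectangle T L u ut ux -> continuous (mass T L u) t.
Proof.
  intros HT HL [_ [Hu _]].
  apply (continuous_RInt_param (fun t x => u (clamp 0 T t) (clamp 0 L x)));
    [ exact HL | ].
  intros t' x'; apply continuity_2d_pt_clamp; auto; lra.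
Qed.

(** Times are kept away from [0] and [T] because at these the clamped function
    has a corner in [t]. *)
Lemma is_derive_mass (T L lam : R) (u ut ux : R -> R -> R) (t : R) :
  0 < T -> 0 < L -> C1_on_rectangle T L u ut ux ->
  (forall t x, Icc 0 T t -> Icc 0 L x -> ut t x + lam * ux t x = 0) ->
  0 < t < T ->
  is_derive (mass T L u) t (- lam * (u t L - u t 0)).
Proof.
  intros HT HL [Hd [Hu [Hut _]]] Heq Ht.
  assert (It : forall t, 0 < t < T -> Icc 0 T t) by (unfold Icc; intros; lra).
  assert (Icl : forall x, Icc 0 L (clamp 0 L x)) by (intros; apply clamp_Icc; lra).
  pose (U := fun t x => u (clamp 0 T t) (clamp 0 L x)).
  assert (HU : forall t x, 0 < t < T ->
    is_derive (fun t => U t x) t (ut t (clamp 0 L x))).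
  { intros t' x' Ht'.
    apply (is_derive_clamp 0 T t' (fun t => u t (clamp 0 L x'))
      (fun t => ut t (clamp 0 L x'))); [ | exact Ht' ].
    apply Hd; auto. }
  assert (Hloc : locally t (fun t => 0 < t < T)).
  { apply filter_and; [ now apply open_gt | now apply open_lt ]. }
  (* Since [ut = - lam * ux] is the [x]-derivative of [- lam * u], its integral
     over the loop is the difference of the end values. *)
  replace (- lam * (u t L - u t 0))
    with (RInt (fun x => Derive (fun t => U t x) t) 0 L).
  - apply (is_derive_RInt_param U).
    + apply filter_imp with (2 := Hloc); intros t' Ht' x _.
      eexists; now apply HU.
    + intros x _.
      apply continuity_2d_pt_ext_loc
        with (fun t x => ut (clamp 0 T t) (clamp 0 L x)).
      * destruct Hloc as [d Hloc]; exists d; intros t' x' Ht' _.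
        specialize (Hloc t' Ht').
        rewrite (clamp_id 0 T t') by auto.
        symmetry; now apply is_derive_unique, HU.
      * apply continuity_2d_pt_clamp; auto; lra.
    + apply filter_forall; intros t'.
      apply (ex_RInt_continuous (V := R_CompleteNormedModule)); intros x _.
      apply (continuity_2d_pt_snd U), continuity_2d_pt_clamp; auto; lra.
  - assert (HC : C1_on_Icc 0 L (fun x => - lam * u t x) (fun x => ut t x)).
    { assert (Hpde : forall x, Icc 0 L x -> - lam * ux t x = ut t x)
        by (intros x Hx; specialize (Heq t x (It t Ht) Hx); lra).
      split.
      - intros y Hy; unfold D_in.
        rewrite <- (Hpde y Hy).
        apply (Dmult_const (Icc 0 L) (fun x => u t x) (fun x => ux t x)).
        now apply Hd; auto.
      - intros x Hx P HP.
        destruct (Hut (t, x) (conj (It t Ht) Hx) P HP) as [d HH].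
        exists d; intros y Hy Dy.
        apply (HH (t, y)); [ split | split; auto ]; [ apply ball_center | exact Hy ]. }
    rewrite (RInt_ext _ (fun x => ut t x)).
    + apply (eq_trans (RInt_one_sided_derivative _ _ _ _ HL HC)).
      apply Rminus_diag_uniq; ring.
    + rewrite Rmin_left, Rmax_right by lra; intros x Hx.
      specialize (HU t x Ht).
      rewrite (clamp_id 0 L x) in HU by (unfold Icc; lra).
      now apply is_derive_unique.
Qed.

(** The two boundary conditions share the control with opposite signs, so the
    weights [lam2] and [lam1] cancel it. *)
Lemma loop_invariant (T L lam1 lam2 Abar : R) (h : R -> R) (r s : R -> R -> R) :
  0 < T -> 0 < L -> loop_solution T L lam1 lam2 Abar h r s ->
  lam2 * mass T L r T + lam1 * mass T L s T =
  lam2 * mass T L r 0 + lam1 * mass T L s 0.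
Proof.
  intros HT HL [rt [rx [st [sx [Cr [Cs [Hpde Hbc]]]]]]].
  destruct (MVT_gen (fun t => lam2 * mass T L r t + lam1 * mass T L s t) 0 T
    (fun _ => 0)) as [c [_ Hc]].
  - rewrite Rmin_left, Rmax_right by lra; intros t Ht.
    assert (It : Icc 0 T t) by (unfold Icc; lra).
    destruct (Hbc t It) as [Hr Hs].
    replace 0 with (plus (scal lam2 (- lam1 * (r t L - r t 0)))
                         (scal lam1 (- lam2 * (s t L - s t 0)))).
    + apply (is_derive_plus (V := R_NormedModule)); apply (is_derive_scal (mass T L _)).
      * apply is_derive_mass with rt rx; auto; intros; now apply Hpde.
      * apply is_derive_mass with st sx; auto; intros; now apply Hpde.
    + rewrite Hr, Hs; unfold plus, scal; simpl; unfold mult; simpl; ring.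
  - intros t _; apply continuity_pt_filterlim.
    apply (continuous_plus (V := R_NormedModule)
      (fun t => scal lam2 (mass T L r t)) (fun t => scal lam1 (mass T L s t)));
      apply (continuous_scal_r (V := R_NormedModule)).
    + now apply continuous_mass with rt rx.
    + now apply continuous_mass with st sx.
  - lra.
Qed.

(** * Obstruction to controllability *)

Lemma constant_data_not_steerable_to_zero (T L lam1 lam2 Abar alpha : R) :
  0 < T -> 0 < L -> 0 < lam2 -> 0 < alpha ->
  ~ steerable T L lam1 lam2 Abar
      (fun _ => alpha * lam2) (fun _ => lam1) (fun _ => 0) (fun _ => 0).
Proof.
  intros HT HL Hlam Ha [h [dh [_ [r [s [Hsol [H0 H1]]]]]]].
  pose proof (loop_invariant _ _ _ _ _ _ _ _ HT HL Hsol) as Hinv.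
  assert (I0 : Icc 0 T 0) by (unfold Icc; lra).
  assert (IT : Icc 0 T T) by (unfold Icc; lra).
  rewrite (mass_const T L r T 0), (mass_const T L s T 0),
    (mass_const T L r 0 (alpha * lam2)), (mass_const T L s 0 lam1) in Hinv;
    auto; try (intros x Hx; now apply H0); try (intros x Hx; now apply H1).
  assert (Hpos : 0 < L * (alpha * lam2 ^ 2 + lam1 ^ 2)).
  { apply Rmult_lt_0_compat; [ exact HL | ].
    apply Rplus_lt_le_0_compat; [ | apply pow2_ge_0 ].
    apply Rmult_lt_0_compat; [ exact Ha | now apply pow_lt ]. }
  lra.
Qed.

Lemma C1_compatible_const (L lam1 lam2 c1 c2 : R) :
  C1_compatible L lam1 lam2 (fun _ => c1) (fun _ => c2).
Proof.
  assert (HC : forall c, C1_on_Icc 0 L (fun _ => c) (fun _ => 0)).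
  { intros c; split.
    - intros y _; apply (Dconst (Icc 0 L) c y).
    - intros y _; apply filterlim_const. }
  exists (fun _ => 0), (fun _ => 0).
  split; [ apply HC | split; [ apply HC | split; ring ] ].
Qed.

Theorem mainTheorem10
  (g : R) (hg : 0 < g)
  (H : R -> R)
  (H_C1 : forall A, 0 < A -> ex_derive H A /\ continuous (Derive H) A)
  (H_incr : forall A, 0 < A -> 0 < Derive H A)
  (L : R) (hL : 0 < L)
  (Abar Vbar : R) (hAbar : 0 < Abar)
  (subcritical : Vbar ^ 2 < g * Abar * Derive H Abar)
  (lam1 lam2 : R)
  (hlam1 : lam1 = Vbar - sqrt (g * Abar * Derive H Abar))
  (hlam2 : lam2 = Vbar + sqrt (g * Abar * Derive H Abar)) :
  (lam1 < 0 < lam2) /\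
  (forall T : R, 0 < T -> ~ exactly_controllable T L lam1 lam2 Abar) /\
  (forall T alpha : R, 0 < T -> 0 < alpha -> 0 < alpha * lam2 + lam1 ->
     ~ exists h dh : R -> R, C1_on_Icc 0 T h dh /\
       exists r s : R -> R -> R,
         loop_solution T L lam1 lam2 Abar h r s /\
         (forall x, 0 <= x <= L -> r 0 x = alpha * lam2 /\ s 0 x = lam1) /\
         (forall x, 0 <= x <= L -> r T x = 0 /\ s T x = 0)).
Proof.
  assert (Hlam : lam1 < 0 < lam2).
  { assert (Hc : Rabs Vbar < sqrt (g * Abar * Derive H Abar)).
    { rewrite <- sqrt_Rsqr_abs; apply sqrt_lt_1_alt.
      unfold Rsqr; split; [ apply Rle_0_sqr | lra ]. }
    apply Rabs_def2 in Hc; lra. }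
  split; [ exact Hlam | split ].
  - intros T HT Hctrl.
    apply (constant_data_not_steerable_to_zero T L lam1 lam2 Abar 1); try lra.
    apply Hctrl; apply C1_compatible_const.
  - intros T alpha HT Halpha _.
    apply (constant_data_not_steerable_to_zero T L lam1 lam2 Abar alpha); lra.
Qed.
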